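(* Let $1\le n\le 84$. Then $nK_2$ admits a $2$-super graceful labeling whose edge-label set is $[2,n+1]$ if and only if $n\equiv 0,3\pmod 4$.
   Context: $nK_2$ denotes the disjoint union of $n$ copies of $K_2$. For integers $a\le b$, $[a,b]$ is the set of integers between $a$ and $b$ inclusive. For $k\ge 1$, a $k$-super graceful labeling of a graph $G=(V,E)$ with $p$ vertices and $q$ edges is a bijection $f:V\cup E\to[k,k+p+q-1]$ with $f(uv)=|f(u)-f(v)|$ for every edge $uv$. *)

(* Defs.v *)
From mathcomp Require Import all_boot all_order all_algebra.

Set Implicit Arguments.
Unset Strict Implicit.
Unset Printing Implicit Defensive.

Record sgraph := SGraph {
  vertex :> finType;
  adj : rel vertex;
  adj_sym : symmetric adj;
  adj_irr : irreflexive adj }.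

Definition edges (G : sgraph) : {set {set G}} :=
  [set e | [exists u : G, exists v : G, adj u v && (e == [set u; v])]].

Definition edge (G : sgraph) : finType := {e : {set G} | e \in edges G}.

Lemma complete_sym n : symmetric (fun i j : 'I_n => i != j).
Proof. by move=> i j; rewrite eq_sym. Qed.

Lemma complete_irr n : irreflexive (fun i j : 'I_n => i != j).
Proof. by move=> i; rewrite eqxx. Qed.

Definition complete_graph (n : nat) : sgraph :=
  SGraph (@complete_sym n) (@complete_irr n).

Section Copies.
Variables (n : nat) (G : sgraph).

Definition copies_adj (x y : 'I_n * G) := (x.1 == y.1) && adj x.2 y.2.

Lemma copies_sym : symmetric copies_adj.
Proof. by move=> x y; rewrite /copies_adj eq_sym adj_sym. Qed.

Lemma copies_irr : irreflexive copies_adj.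
Proof. by move=> x; rewrite /copies_adj adj_irr andbF. Qed.

Definition copies : sgraph := SGraph copies_sym copies_irr.

End Copies.

Definition image_is (T : Type) (g : T -> nat) (a b : nat) : Prop :=
  forall m : nat, (exists x : T, g x = m) <-> a <= m <= b.

(* The set V \cup E is the (disjoint) sum of the vertex and edge types; the
   notion is meant for 1 <= k, so the subtraction below never truncates. *)
Definition super_graceful (k : nat) (G : sgraph) (f : G + edge G -> nat) : Prop :=
  [/\ injective f,
      image_is f k (k + #|G| + #|edges G| - 1)
    & forall (e : edge G) (u v : G), val e = [set u; v] ->
        f (inr e) = `|f (inl u) - f (inl v)|%N].

Definition edge_labels_are (G : sgraph) (f : G + edge G -> nat) (a b : nat) : Prop :=
  image_is (fun e : edge G => f (inr e)) a b.

(* Main.v *)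
Require Import Defs.
From mathcomp Require Import all_boot all_order all_algebra.
From mathcomp Require Import zify.

(* Since x + y + |x - y| = 2 max(x, y), the labels of each copy of K_2 have an
   even sum, so the sum 9n(n + 1)/2 of [2, 3n + 1] is even and n = 0, 3 mod 4.
   Conversely, if the edges are labelled [2, n + 1] then the vertices are
   labelled by the 2n consecutive integers [n + 2, 3n + 1], paired up with
   differences 2, ..., n + 1: this is a Langford sequence of order n. *)

(** * Langford sequences *)

(* Davies' Langford word of order n = 4m - r, that is, n = 4m or n = 4m - 1:
   [langford_pos m r k] is the position, counted from 0, of the first k in a
   word of length 2n in which the two copies of each k in [1, n] are k + 1 apart.
   With dots in steps of 2, the word for n = 4m is
     4m-4 .. 2m, 4m-2, 2m-3 .. 1, 4m-1, 1 .. 2m-3, 2m .. 4m-4, 4m,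
     4m-3 .. 2m+1, 4m-2, 2m-2 .. 2, 2m-1, 4m-1, 2 .. 2m-2, 2m+1 .. 4m-3, 2m-1, 4m;
   for n = 4m - 1 the first 4m becomes 2m-1 and the last two letters are dropped. *)
Definition langford_pos (m : nat) (r : bool) (k : nat) : nat :=
  if k == 4 * m then 4 * m - 2
  else if k == 4 * m - 1 then 2 * m - 1
  else if k == 4 * m - 2 then m - 1
  else if k == 2 * m - 1 then if r then 4 * m - 2 else 6 * m - 2
  else if odd k then if k < 2 * m then 2 * m - 2 - k./2 else 6 * m - 3 - k./2
  else if k < 2 * m then 6 * m - 2 - k./2 else 2 * m - 2 - k./2.

(** The branches of [langford_pos] as a view: the half [k./2] becomes an explicit [t] with its
    range, so that later goals are linear for [lia]. *)
Variant langford_pos_spec (m : nat) (r : bool) : nat -> nat -> Prop :=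
| LangfordLast of ~~ r : langford_pos_spec m r (4 * m) (4 * m - 2)
| LangfordPred : langford_pos_spec m r (4 * m - 1) (2 * m - 1)
| LangfordPred2 : langford_pos_spec m r (4 * m - 2) (m - 1)
| LangfordMiddle of r : langford_pos_spec m r (2 * m - 1) (4 * m - 2)
| LangfordMiddle' of ~~ r : langford_pos_spec m r (2 * m - 1) (6 * m - 2)
| LangfordOddSmall t of t + 1 < m :
    langford_pos_spec m r (1 + 2 * t) (2 * m - 2 - t)
| LangfordOddLarge t of m <= t & t + 2 <= 2 * m :
    langford_pos_spec m r (1 + 2 * t) (6 * m - 3 - t)
| LangfordEvenSmall t of 0 < t & t < m :
    langford_pos_spec m r (2 * t) (6 * m - 2 - t)
| LangfordEvenLarge t of m <= t & t + 2 <= 2 * m :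
    langford_pos_spec m r (2 * t) (2 * m - 2 - t).

Lemma langford_posP m (r : bool) k : 0 < m -> 0 < k <= 4 * m - r ->
  langford_pos_spec m r k (langford_pos m r k).
Proof.
move=> m0 /andP[k0 kn]; rewrite /langford_pos.
case: eqP => [k1|k1]; first by rewrite k1; constructor; case: r kn => //; lia.
case: eqP => [->|k2]; first by constructor.
case: eqP => [->|k3]; first by constructor.
case: eqP => [->|k4]; first by case: r {kn}; constructor.
(* Outside the four special letters, parity and comparison with [2 * m] determine the branch. *)
have := odd_double_half k; rewrite -muln2 mulnC; set t := k./2.
case: (odd k) => /= kE; rewrite -kE in kn k0 k1 k2 k3 k4 *;
  by case: ltnP => hkm; rewrite ?add0n; constructor; case: r kn => ?; lia.
Qed.

Lemma langford_pos_bound m (r : bool) k : 0 < m -> 0 < k <= 4 * m - r ->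
  langford_pos m r k + k.+1 < 2 * (4 * m - r).
Proof.
by case: r => m0 hk; case: (langford_posP _ _ _ m0 hk) => //= *; lia.
Qed.

(** The flags [b] and [c] select the first or second copy of a letter: no position of the word is
    used twice. *)
Lemma langford_pos_inj m (r : bool) k l (b c : bool) : 0 < m ->
  0 < k <= 4 * m - r -> 0 < l <= 4 * m - r ->
  langford_pos m r k + (if b then k.+1 else 0)
    = langford_pos m r l + (if c then l.+1 else 0) ->
  k = l /\ b = c.
Proof.
move=> m0 hk hl.
(* The flags are compared in [nat], which leaves pure arithmetic in each case. *)
suff H : langford_pos m r k + (if b then k.+1 else 0)
    = langford_pos m r l + (if c then l.+1 else 0) -> k = l /\ (b : nat) = c.
  by move=> /H[-> bc]; split=> //; case: b c bc {H} => [] [].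
case: r hk hl => hk hl; case: (langford_posP _ _ _ m0 hk) => //;
  case: (langford_posP _ _ _ m0 hl) => //; clear hk hl; move: b c => [] [] /= *; lia.
Qed.

(** * Labellings onto an interval *)

(** Pigeonhole: an injection into an interval of [#|T|] integers is onto. *)
Lemma image_is_injective_range (T : finType) (g : T -> nat) (a : nat) :
  0 < #|T| -> injective g -> (forall x, a <= g x < a + #|T|) ->
  image_is g a (a + #|T| - 1).
Proof.
move=> T0 injg hg m; split=> [[x <-]|hm]; first by have := hg x; lia.
suff /mapP[x _ ->] : m \in map g (enum T) by exists x.
have sub : {subset map g (enum T) <= iota a #|T|}.
  by move=> _ /mapP[x _ ->]; rewrite mem_iota.
have [||_ ->] := uniq_min_size _ sub; last by rewrite mem_iota; lia.
  by rewrite map_inj_uniq ?enum_uniq.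
by rewrite size_map size_iota cardE.
Qed.

Lemma sum_image_is (T : finType) (g : T -> nat) (a b : nat) :
  injective g -> image_is g a b -> \sum_x g x = \sum_(a <= i < b.+1) i.
Proof.
move=> injg hg; rewrite -(big_map g predT id) /=.
apply: perm_big; apply: uniq_perm; rewrite ?iota_uniq ?map_inj_uniq ?index_enum_uniq //.
move=> m; rewrite mem_index_iota ltnS; apply/mapP/idP => [[x _ ->]|/hg[x <-]].
  by apply/hg; exists x.
by exists x; rewrite ?mem_index_enum.
Qed.

Lemma sum_nat_double n : (\sum_(0 <= i < n) i) * 2 = n * (n - 1).
Proof. by elim: n => [|n IH]; rewrite ?big_nil // big_nat_recr //= mulnDl IH; nia. Qed.

(** * Vertices and edges of nK_2 *)

Section Matching.
Variable n : nat.
Let G := copies n (complete_graph 2).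

Definition copy_end (i : 'I_n) (b : bool) : G := (i, if b then ord_max else ord0).

Definition copy_edge_set (i : 'I_n) : {set G} := [set copy_end i false; copy_end i true].

Lemma matching_vertexP (u : G) : exists i b, u = copy_end i b.
Proof.
case: u => i [[|[|//]] h]; exists i; [exists false | exists true];
  by congr pair; apply: val_inj.
Qed.

(** The edge condition ranges over ordered pairs [u], [v]; both orientations of a copy have to be
    handled. *)
Lemma copy_edge_ends i (u v : G) : copy_edge_set i = [set u; v] ->
  exists b, u = copy_end i b /\ v = copy_end i (~~ b).
Proof.
move=> iE.
have end_in w : w \in [set u; v] -> exists b, w = copy_end i b.
  by rewrite -iE !inE => /orP[] /eqP ->; [exists false | exists true].
have [b uE] := end_in u (set21 u v); have [c vE] := end_in v (set22 u v).
exists b; split=> //; rewrite vE; case: (c =P ~~ b) => [-> //|].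
have : copy_end i (~~ b) \in [set u; v] by rewrite -iE !inE; case: b uE; rewrite eqxx ?orbT.
by rewrite uE vE !inE; case: b c {uE vE} => [] [] // /orP[] /eqP [].
Qed.

Lemma copy_edge_subproof (i : 'I_n) : copy_edge_set i \in edges G.
Proof.
rewrite inE; apply/existsP; exists (copy_end i false).
by apply/existsP; exists (copy_end i true); rewrite /= /copies_adj /= !eqxx.
Qed.

Definition copy_edge (i : 'I_n) : edge G := Sub (copy_edge_set i) (copy_edge_subproof i).

Lemma copy_edge_set_inj : injective copy_edge_set.
Proof.
move=> i j ij; have : copy_end i false \in copy_edge_set j by rewrite -ij !inE eqxx.
by rewrite !inE => /orP[] /eqP [].
Qed.

Lemma copy_edge_inj : injective copy_edge.
Proof. by move=> i j /(congr1 val) /copy_edge_set_inj. Qed.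

Lemma copy_edge_surj (e : edge G) : exists i, e == copy_edge i.
Proof.
case: e => e he; have := he; rewrite inE => /existsP[u /existsP[v /andP[uv /eqP eE]]].
have [i [b uE]] := matching_vertexP u; have [j [c vE]] := matching_vertexP v.
move: uv eE; rewrite {}uE {}vE /= /copies_adj /= => /andP[/eqP <- bc] eE.
exists i; rewrite -val_eqE /= eE /copy_edge_set.
by case: b c bc {eE} => [] [] //= _; rewrite setUC.
Qed.

Definition edge_copy (e : edge G) : 'I_n := xchoose (copy_edge_surj e).

Lemma edge_copyK : cancel edge_copy copy_edge.
Proof. by move=> e; rewrite -(eqP (xchooseP (copy_edge_surj e))). Qed.

Lemma copy_edgeK : cancel copy_edge edge_copy.
Proof. by move=> i; apply: copy_edge_inj; rewrite edge_copyK. Qed.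

Lemma card_matching_edge : #|{: edge G}| = n.
Proof. by rewrite -(bij_eq_card (Bijective copy_edgeK edge_copyK)) card_ord. Qed.

Lemma card_matching_edges : #|edges G| = n.
Proof. by rewrite -[RHS]card_matching_edge card_sig; apply: eq_card. Qed.

Lemma card_matching : #|G| = n * 2.
Proof. by rewrite card_prod !card_ord. Qed.

Lemma sum_matching (F : G + edge G -> nat) :
  \sum_x F x = \sum_i (F (inl (copy_end i false)) + F (inl (copy_end i true))
                       + F (inr (copy_edge i))).
Proof.
rewrite big_sumType /= big_split /=; congr (_ + _); last first.
  by rewrite (reindex copy_edge) //; apply: onW_bij; exists edge_copy;
    [exact: copy_edgeK | exact: edge_copyK].
transitivity (\sum_(i < n) \sum_(j < 2) F (inl (i, j))).
  by rewrite pair_bigA; apply: eq_bigr => -[].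
apply: eq_bigr => i _; rewrite big_ord_recl big_ord1.
by congr (F (inl (_, _)) + F (inl (_, _))); apply: val_inj.
Qed.

(** * Necessity of the congruence *)

Lemma super_graceful_matching_mod4 (f : G + edge G -> nat) :
  super_graceful 2 f -> n = 0 %[mod 4] \/ n = 3 %[mod 4].
Proof.
case=> injf imf edgef; have := sum_image_is _ _ _ _ injf imf.
rewrite card_matching card_matching_edges sum_matching.
have -> : (2 + n * 2 + n - 1).+1 = 2 + 3 * n by lia.
under eq_bigr => i _.
  rewrite (edgef _ (copy_end i false) (copy_end i true)) //.
  have -> : forall x y : nat, x + y + `|x - y|%N = maxn x y * 2 by move=> x y; lia.
  over.
rewrite -big_distrl /=; move: (\sum_(i < n) _) => S SE.
have := sum_nat_double (2 + 3 * n).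
(* Splitting off the terms 0 and 1 gives 2(1 + 2S) = (3n + 2)(3n + 1). *)
rewrite (@big_cat_nat _ _ _ 2) //= -SE big_nat_recl // big_nat1 => H.
have {}H : S * 4 = 9 * (n * (n + 1)) by nia.
have := divn_eq n 4; have := ltn_pmod n (isT : 0 < 4).
move: (n %/ 4) (n %% 4) H => q r H r4 nE.
(* For r = 1, 2 the product n(n + 1) is 2 mod 4, so 4 does not divide 9n(n + 1). *)
suff : (r == 0) || (r == 3) by case/orP => /eqP ->; [left | right].
by case: r r4 nE => [|[|[|[|//]]]] _ nE //=; nia.
Qed.

(** * Labelling from a Langford sequence *)

(** Copy [i] plays the letter i + 1: its ends get the two positions of that letter shifted by n + 2,
    its edge their distance i + 2. *)
Lemma matching_super_graceful (p : 'I_n -> nat) : 0 < n ->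
  (forall i, p i + (i + 2) < 2 * n) ->
  (forall i j (b c : bool),
     p i + (if b then i + 2 else 0) = p j + (if c then j + 2 else 0) ->
     i = j /\ b = c) ->
  exists f : G + edge G -> nat, super_graceful 2 f /\ edge_labels_are f 2 (n + 1).
Proof.
move=> n0 pbound pinj.
pose f (x : G + edge G) := match x with
  | inl u => n + 2 + (p u.1 + if u.2 == ord0 then 0 else u.1 + 2)
  | inr e => edge_copy e + 2
  end.
have fv i b : f (inl (copy_end i b)) = n + 2 + (p i + if b then i + 2 else 0).
  by case: b.
have vertex_range u : n + 1 < f (inl u) < 3 * n + 2.
  have [i [b ->]] := matching_vertexP u.
  by rewrite fv; have := pbound i; case: b; lia.
have edge_range e : 1 < f (inr e) < n + 2 by have := ltn_ord (edge_copy e); simpl; lia.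
have injf : injective f.
  move=> [u|e] [v|e'] E.
  - have [i [b uE]] := matching_vertexP u; have [j [c vE]] := matching_vertexP v.
    by move: E; rewrite uE vE !fv => /addnI /pinj[-> ->].
  - by have := vertex_range u; have := edge_range e'; lia.
  - by have := vertex_range v; have := edge_range e; lia.
  - by move: E => /= /addIn /ord_inj /(can_inj edge_copyK) ->.
have card_sum_matching : #|{: G + edge G}| = 3 * n.
  by rewrite card_sum card_matching card_matching_edge; lia.
exists f; split; [split=> //|].
- have := @image_is_injective_range _ f 2; rewrite card_sum_matching.
  rewrite card_matching card_matching_edges.
  have -> : 2 + n * 2 + n - 1 = 2 + 3 * n - 1 by lia.
  apply=> //; first by lia.
  by case=> [u|e]; [have := vertex_range u | have := edge_range e]; lia.
- move=> e u v; rewrite -{1}[e]edge_copyK => /copy_edge_ends[b [-> ->]].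
  by rewrite !fv /=; case: b => /=; lia.
- have := @image_is_injective_range _ (f \o inr) 2; rewrite card_matching_edge.
  have -> : 2 + n - 1 = n + 1 by lia.
  apply=> // [e e' /injf[] //|e].
  by have := edge_range e; simpl; lia.
Qed.

End Matching.

Theorem theorem3p18 (n : nat) (hn : 1 <= n <= 84) :
  (exists f : copies n (complete_graph 2) + edge (copies n (complete_graph 2)) -> nat,
      super_graceful 2 f /\ edge_labels_are f 2 (n + 1))
  <-> (n = 0 %[mod 4] \/ n = 3 %[mod 4]).
Proof.
split=> [[f [/super_graceful_matching_mod4]] //|nmod].
have [m [r [m0 nE]]] : exists m (r : bool), 0 < m /\ n = 4 * m - r.
  (* If n = 4q + 3, then n = 4(q + 1) - 1; if n = 4q, then q is positive since n is. *)
  by case: nmod => nmod; [exists (n %/ 4), false | exists (n %/ 4).+1, true];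
    rewrite /=; lia.
have krange (i : 'I_n) : 0 < i.+1 <= 4 * m - r by rewrite -nE /=.
apply: (@matching_super_graceful n (fun i => langford_pos m r i.+1)).
- by case/andP: hn.
- by move=> i; have := langford_pos_bound _ _ _ m0 (krange i); rewrite -nE; lia.
- move=> i j b c; rewrite !addn2 => /(langford_pos_inj _ _ _ _ _ _ m0 (krange i) (krange j)).
  by case=> /succn_inj /ord_inj -> ->.
Qed.
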